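(* For any weighted digraph $\Gamma$ with Kirchhoff matrix $L$ and out forest dimension $v$, and any $k=0,\dots,n-v$, $$Q_k=\sum_{i=0}^{k}\sigma_{k-i}\,(-L)^{i},$$ where $Q_k$ is the matrix of out forests of $\Gamma$ with $k$ arcs and $\sigma_j$ is the total weight of all out forests of $\Gamma$ with $j$ arcs.
   Context: $\Gamma$ is a weighted digraph without loops with vertex set $\{1,\dots,n\}$, $n>1$; all arcs have strictly positive real weights; $\varepsilon_{ij}$ denotes the weight of the arc from $i$ to $j$, with $\varepsilon_{ij}=0$ if and only if there is no such arc. The Kirchhoff matrix $L=(\ell_{ij})$ is the $n\times n$ matrix with $\ell_{ij}=-\varepsilon_{ji}$ for $j\ne i$ and $\ell_{ii}=-\sum_{k\ne i}\ell_{ik}$. A diverging forest is a digraph without (directed) circuits in which every vertex has indegree at most 1; its weak components are diverging trees, each having a unique vertex of indegree 0 (its root) from which all vertices of the tree are reachable; one says the tree diverges from its root. An out forest of $\Gamma$ is a spanning subgraph of $\Gamma$ that is a diverging forest. The weight of a subgraph is the product of the weights of its arcs (1 if it has no arcs); the weight $\varepsilon(\mathcal G)$ of a set $\mathcal G$ of subgraphs is the sum of the weights of its elements (0 for the empty set). The out forest dimension $v$ is the minimum number of weak components of an out forest of $\Gamma$, so the maximum number of arcs of an out forest is $n-v$. $\mathcal F_k$ is the set of out forests of $\Gamma$ with $k$ arcs; $\mathcal F_k^{j\to i}$ is the set of those in which $i$ belongs to a tree diverging from $j$ (i.e. with root $j$). $\sigma_k=\varepsilon(\mathcal F_k)$,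 and $Q_k=(q^k_{ij})$ with $q^k_{ij}=\varepsilon(\mathcal F_k^{j\to i})$, $i,j=1,\dots,n$. *)

(* Defs.v *)
From mathcomp Require Import all_boot all_order all_algebra.
Set Implicit Arguments.
Unset Strict Implicit.
Unset Printing Implicit Defensive.
Import Order.TTheory GRing.Theory Num.Theory.
Local Open Scope ring_scope.

(* The arcs of a weighted digraph are not stored: i -> j is an arc exactly when
   its weight is nonzero, and then the weight is strictly positive. *)
Record wdigraph (R : realFieldType) (n : nat) := WDigraph {
  weight : 'I_n -> 'I_n -> R;
  weight_ge0 : forall i j, 0 <= weight i j;
  weight_loopless : forall i, weight i i = 0
}.

Definition arcs (R : realFieldType) (n : nat) (G : wdigraph R n) :
    {set 'I_n * 'I_n} :=
  [set a | weight G a.1 a.2 != 0].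

Definition kirchhoff (R : realFieldType) (n : nat) (G : wdigraph R n) :
    'M[R]_n :=
  \matrix_(i, j) if j == i then - \sum_(k | k != i) - weight G k i
                 else - weight G j i.

(* A spanning subgraph is identified with its arc set F; the pair (x, y) is
   the arc from x to y. *)
Section SpanningSubgraph.
Variables (n : nat) (F : {set 'I_n * 'I_n}).

Definition arc_rel : rel 'I_n := fun x y => (x, y) \in F.

Definition weak_rel : rel 'I_n := fun x y => arc_rel x y || arc_rel y x.

Definition indegree (y : 'I_n) : nat := #|[set x | arc_rel x y]|.

(* A circuit visits each of its vertices once, so its length is at most n. *)
Definition acyclic : bool :=
  [forall m : 'I_n.+1, forall c : m.-tuple 'I_n,
    (0 < m)%N ==> ~~ ucycleb arc_rel c].

Definition diverging_forest : bool :=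
  acyclic && [forall y, (indegree y <= 1)%N].

Definition weak_components : nat := n_comp weak_rel predT.

(* i lies in the weak component whose vertex of indegree 0 is j. *)
Definition diverges_from (j i : 'I_n) : bool :=
  (indegree j == 0%N) && connect weak_rel j i.

End SpanningSubgraph.

Section OutForests.
Variables (R : realFieldType) (n : nat) (G : wdigraph R n).

Definition out_forest (F : {set 'I_n * 'I_n}) : bool :=
  (F \subset arcs G) && diverging_forest F.

(* The default value n is the number of weak components of the arcless spanning
   subgraph, which is always an out forest. *)
Definition out_forest_dim : nat :=
  \big[minn/n]_(F : {set 'I_n * 'I_n} | out_forest F) weak_components F.

Definition subgraph_weight (F : {set 'I_n * 'I_n}) : R :=
  \prod_(a in F) weight G a.1 a.2.

Definition set_weight (S : {set {set 'I_n * 'I_n}}) : R :=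
  \sum_(F in S) subgraph_weight F.

Definition out_forests (k : nat) : {set {set 'I_n * 'I_n}} :=
  [set F | out_forest F & #|F| == k].

Definition out_forests_from (k : nat) (j i : 'I_n) :
    {set {set 'I_n * 'I_n}} :=
  [set F in out_forests k | diverges_from F j i].

Definition sigma (k : nat) : R := set_weight (out_forests k).

Definition Qmx (k : nat) : 'M[R]_n :=
  \matrix_(i, j) set_weight (out_forests_from k j i).

End OutForests.

(* Main.v *)
(* Fix a vertex i. An out forest in which i is not a root is, in a unique way,
   an out forest H in which i is a root together with one arc from p to i,
   where p lies outside the tree of i in H; adding this arc merges the tree of
   i into the tree of p. Expressing both sides of
     Q_{k+1} = sigma_{k+1} I - L Q_k
   as sums over the out forests H rooted at i turns row i of this recurrence
   into an identity between the sums of weight p i over the trees of H. The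
   theorem follows by induction on k. *)
Require Import Defs.
From mathcomp Require Import all_boot all_order all_algebra.
From mathcomp Require Import ring.
Import Order.TTheory GRing.Theory Num.Theory.
Local Open Scope ring_scope.

Set Implicit Arguments.
Unset Strict Implicit.
Unset Printing Implicit Defensive.

(** * Connectivity, roots and arc insertion in diverging forests *)

Section Forests.
Variable n : nat.
Implicit Types (F H : {set 'I_n * 'I_n}) (i j m p x y : 'I_n).

Lemma weak_connect_sym F : connect_sym (weak_rel F).
Proof. by apply: sym_connect_sym => x y; rewrite /weak_rel orbC. Qed.

Lemma sub_connect_weak F x y :
  connect (arc_rel F) x y -> connect (weak_rel F) x y.
Proof.
by apply: connect_sub => a b ab; apply: connect1; rewrite /weak_rel ab.
Qed.

Lemma acyclicP F :
  reflect (forall x y, (x, y) \in F -> ~~ connect (arc_rel F) y x) (acyclic F).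
Proof.
apply: (iffP idP) => [acF x y Fxy | acF].
  apply/negP => /connectP[p0 yp0 ex0].
  case/shortenP: yp0 ex0 => p yp Up _ ex.
  (* A path without repetitions has at most [n] vertices, so the circuit it closes falls within the
     length bound of [acyclic]. *)
  have sz : (size (y :: p) < n.+1)%N.
    by rewrite -(card_uniqP Up) ltnS -[leqRHS]card_ord max_card.
  move/forallP/(_ (Ordinal sz))/forallP/(_ (in_tuple (y :: p))): acF.
  by rewrite /ucycleb /= rcons_path yp -ex /arc_rel Fxy -/(uniq (y :: p)) Up.
apply/forallP => m; apply/forallP => c; apply/implyP => m_gt0.
rewrite -(size_tuple c) in m_gt0.
apply/negP => /andP[cyc _]; case: (tval c) m_gt0 cyc => [//|x s] _ /=.
case: s => [|y s] /= /andP[Fxy ys]; apply/negP: (acF _ _ Fxy); apply/negPn.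
  exact: connect0.
by apply/connectP; exists (rcons s x); rewrite ?last_rcons.
Qed.

Lemma arc_uniq F x y z :
  (indegree F z <= 1)%N -> (x, z) \in F -> (y, z) \in F -> x = y.
Proof. by move/card_le1_eqP => h Fx Fy; apply: h; rewrite inE. Qed.

Lemma indegree0P F i : reflect (forall x, (x, i) \notin F) (indegree F i == 0%N).
Proof.
rewrite cards_eq0; apply: (iffP eqP) => [h x | h].
  by move/setP/(_ x): h; rewrite !inE => /negbT.
by apply/setP => x; rewrite !inE; apply/negbTE/h.
Qed.

(** A weak path that starts at a root can step against an arc only by retracing the arc just used,
    because indegrees are at most 1. *)
Lemma root_connect F i x :
    (forall y, (indegree F y <= 1)%N) -> indegree F i == 0%N ->
  connect (weak_rel F) i x -> connect (arc_rel F) i x.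
Proof.
move=> deg1 /indegree0P rooti /connectP[p ip ->].
elim/last_ind: p ip => [|p y IHp]; first by rewrite connect0.
rewrite rcons_path last_rcons => /andP[/IHp ip] /orP[py|yp].
  by apply: (connect_trans ip); apply: connect1.
case/connectP: ip => q iq elast; move: yp; rewrite elast.
(* The vertex reached so far is either the root, which no arc enters, or has a predecessor [z] on
   the directed path, and then [y = z]. *)
case/lastP: q iq {elast} => [_ /=|q z]; first by rewrite /arc_rel (negPf (rooti y)).
rewrite rcons_path last_rcons => /andP[iq qz] yz.
by rewrite (arc_uniq (deg1 z) yz qz); apply/connectP; exists q.
Qed.

Lemma root_uniq F i j :
    (forall y, (indegree F y <= 1)%N) ->
    indegree F i == 0%N -> indegree F j == 0%N ->
  connect (weak_rel F) i j -> i = j.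
Proof.
move=> deg1 ri /indegree0P rj /(root_connect deg1 ri)/connectP[p ip ej].
case/lastP: p ip ej => [//|p z]; rewrite rcons_path last_rcons => /andP[_ pz] ej.
by move: pz; rewrite -ej /arc_rel (negPf (rj _)).
Qed.

Lemma connect_arc_addP F p i x y :
  connect (arc_rel ((p, i) |: F)) x y ->
  connect (arc_rel F) x y \/ connect (arc_rel F) x p /\ connect (arc_rel F) i y.
Proof.
case/connectP=> s xs ->{y}; elim: s x xs => [|z s IHs] x /=; first by left.
case/andP; rewrite {1}/arc_rel in_setU1 => xz /IHs zs.
case/orP: xz => [/eqP[-> zi]|Fxz].
  by right; split; [exact: connect0 | move: zs; rewrite zi => -[|[]]].
have cxz : connect (arc_rel F) x z by apply: connect1.
case: zs => [zs|[zp zs]]; [left|right]; first exact: connect_trans zs.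
by split=> //; apply: connect_trans zp.
Qed.

Lemma connect_weak_add F p i x y :
  connect (weak_rel ((p, i) |: F)) x y =
  [|| connect (weak_rel F) x y,
      connect (weak_rel F) x p && connect (weak_rel F) i y
    | connect (weak_rel F) x i && connect (weak_rel F) p y].
Proof.
apply/idP/idP.
  case/connectP=> s xs ->{y}; elim: s x xs => [|z s IHs] x /=.
    by rewrite connect0.
  case/andP; rewrite {1}/weak_rel /arc_rel !in_setU1 => xz /IHs.
  have [Fxz|nFxz] := boolP (weak_rel F x z).
    have cxz a : connect (weak_rel F) z a -> connect (weak_rel F) x a.
      by apply: connect_trans; apply: connect1.
    by case/or3P=> [/cxz ->|/andP[/cxz -> ->]|/andP[/cxz -> ->]]; rewrite ?orbT.
  have : ((x, z) == (p, i)) || ((z, x) == (p, i)).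
    by move: nFxz xz; rewrite /weak_rel /arc_rel;
      do 4!case: (_ \in _) || case: (_ == _).
  case/orP=> /eqP[-> ->]; rewrite !connect0 /=.
    by case/or3P=> [->|/andP[_ ->]|->]; rewrite ?orbT.
  by case/or3P=> [->|->|/andP[_ ->]]; rewrite ?orbT.
have sub a b : connect (weak_rel F) a b -> connect (weak_rel ((p, i) |: F)) a b.
  apply: connect_sub => c d cd; apply: connect1; move: cd.
  by rewrite /weak_rel /arc_rel !in_setU1 => /orP[]->; rewrite !orbT.
have pi : connect (weak_rel ((p, i) |: F)) p i.
  by apply: connect1; rewrite /weak_rel /arc_rel setU11.
case/or3P=> [/sub //|/andP[/sub xp /sub iy]|/andP[/sub xi /sub py]].
  exact: connect_trans xp (connect_trans pi iy).
by apply: connect_trans xi (connect_trans _ py); rewrite weak_connect_sym.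
Qed.

Lemma indegree_add F p i y : (p, i) \notin F ->
  indegree ((p, i) |: F) y = ((y == i) + indegree F y)%N.
Proof.
move=> nF; rewrite /indegree; case: eqP => [->|/eqP yi].
  have -> : [set x | arc_rel ((p, i) |: F) x i] = p |: [set x | arc_rel F x i].
    by apply/setP => x; rewrite !inE /arc_rel in_setU1 xpair_eqE eqxx andbT.
  by rewrite cardsU1 inE /arc_rel nF.
by apply: eq_card => x; rewrite !inE /arc_rel in_setU1 xpair_eqE (negPf yi) andbF.
Qed.

Definition rooted_forest F i := diverging_forest F && (indegree F i == 0%N).

(** Indegree at most 1 after the insertion forces [i] to be a root before it. A circuit through the
    new arc amounts to a directed path from [i] to [p], and from a root weak and directed
    reachability agree. *)
Lemma rooted_forest_add F p i : (p, i) \notin F ->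
  diverging_forest ((p, i) |: F) =
  rooted_forest F i && ~~ connect (weak_rel F) i p.
Proof.
move=> nF; apply/idP/idP.
  case/andP=> /acyclicP acF /forallP deg1.
  have deg0 : indegree F i == 0%N.
    by move: (deg1 i); rewrite indegree_add // eqxx; case: (indegree F i).
  have deg1F y : (indegree F y <= 1)%N.
    by apply: leq_trans (deg1 y); rewrite indegree_add // leq_addl.
  have sub a b : connect (arc_rel F) a b -> connect (arc_rel ((p, i) |: F)) a b.
    apply: connect_sub => c d cd; apply: connect1; move: cd.
    by rewrite /arc_rel !in_setU1 => ->; rewrite orbT.
  rewrite /rooted_forest /diverging_forest deg0 andbT -andbA; apply/and3P; split.
  - apply/acyclicP=> x y Fxy; apply: contra (acF x y _); first exact: sub.
    by rewrite in_setU1 Fxy orbT.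
  - exact/forallP.
  - apply: contra (acF p i (setU11 _ _)) => /(root_connect deg1F deg0).
    exact: sub.
case/andP=> /andP[/andP[/acyclicP acF /forallP deg1] deg0] nip.
have nip' : ~~ connect (arc_rel F) i p
  by apply: contra nip; apply: sub_connect_weak.
apply/andP; split; last first.
  apply/forallP=> y; rewrite indegree_add //; case: eqP => [->|_]; last exact: deg1.
  by rewrite (eqP deg0).
apply/acyclicP => x y; rewrite in_setU1 => Fxy; apply/negP => /connect_arc_addP yx.
case/orP: Fxy => [/eqP[ex ey]|Fxy].
  by move: yx; rewrite ex ey (negPf nip') => -[|[]].
case: yx => [yx|[yp ix]]; first by move/negP: (acF _ _ Fxy).
move/negP: nip'; apply; apply: (connect_trans ix); apply: connect_trans yp.
exact: connect1.
Qed.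

Lemma rooted_disjoint F i j x : rooted_forest F i -> i != j ->
  ~~ (diverges_from F j x && connect (weak_rel F) i x).
Proof.
move=> /andP[/andP[_ /forallP deg1] ri] nij; apply/negP => /andP[/andP[rj jx] ix].
move/eqP: nij; apply; apply: (root_uniq deg1 ri rj).
by apply: connect_trans ix _; rewrite weak_connect_sym.
Qed.

(** The tree of [i] is grafted at [p], so its vertices inherit the root of [p]. The remaining case
    of [connect_weak_add] would join the distinct roots [i] and [j]. *)
Lemma diverges_from_add F p i j x :
    rooted_forest F i -> ~~ connect (weak_rel F) i p -> i != j ->
  diverges_from ((p, i) |: F) j x =
  diverges_from F j x || diverges_from F j p && connect (weak_rel F) i x.
Proof.
move=> Fi nip nij; have nF : (p, i) \notin F.
  by apply: contra nip => Fpi; apply: connect1; rewrite /weak_rel /arc_rel Fpi orbT.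
rewrite /diverges_from indegree_add // [j == i]eq_sym (negPf nij) add0n
  connect_weak_add.
have := rooted_disjoint i Fi nij; rewrite /diverges_from connect0 andbT.
by case: (_ == 0%N) => //= /negPf ->; rewrite orbF.
Qed.

Lemma diverging_forest0 : diverging_forest (set0 : {set 'I_n * 'I_n}).
Proof.
apply/andP; split; first by apply/acyclicP=> x y; rewrite inE.
apply/forallP=> y; have /eqP-> // : indegree (set0 : {set 'I_n * 'I_n}) y == 0%N.
by apply/indegree0P=> x; rewrite inE.
Qed.

Lemma diverges_from0 i j : diverges_from (set0 : {set 'I_n * 'I_n}) j i = (i == j).
Proof.
rewrite /diverges_from; have -> : indegree (set0 : {set 'I_n * 'I_n}) j == 0%N.
  by apply/indegree0P=> x; rewrite inE.
apply/idP/eqP => /= [/connectP[[|z s] /= js ->] //|->]; last exact: connect0.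
by move: js; rewrite /weak_rel /arc_rel !inE.
Qed.

End Forests.

(** * Weighted sums over forests and the matrix recurrence *)

Section Recurrence.
Variables (R : realFieldType) (n : nat) (G : wdigraph R n).
Implicit Types (F H : {set 'I_n * 'I_n}) (i j m p x y : 'I_n) (k : nat).

Local Notation w := (subgraph_weight G).
Local Notation eps := (weight G).

(** This lets the sums below range over all diverging forests on the vertex set, with no reference
    to the arcs of [G]. *)
Lemma subgraph_weight_eq0 F : ~~ (F \subset arcs G) -> w F = 0.
Proof.
case/subsetPn => a Fa; rewrite inE negbK => /eqP a0.
by rewrite /subgraph_weight (bigD1 a) //= a0 mul0r.
Qed.

Lemma sigmaE k : sigma G k = \sum_(F | diverging_forest F && (#|F| == k)) w F.
Proof.
rewrite /sigma /set_weight big_mkcond [RHS]big_mkcond; apply: eq_bigr => F _.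
rewrite inE /out_forest -andbA.
by have [//|/subgraph_weight_eq0 ->] := boolP (F \subset arcs G); rewrite !if_same.
Qed.

Lemma QmxE k i j : Qmx G k i j =
  \sum_(F | diverging_forest F && (#|F| == k)) w F * (diverges_from F j i)%:R.
Proof.
rewrite mxE /set_weight big_mkcond [RHS]big_mkcond; apply: eq_bigr => F _.
rewrite !inE /out_forest; have [_|/subgraph_weight_eq0 ->] := boolP (F \subset _).
  by do 2!case: ifP => //=; case: diverges_from;
    rewrite ?mulr1 ?mulr0 ?andbT ?andbF // => ->.
by rewrite mul0r !if_same.
Qed.

(* The condition #|H|.+1 == k makes the second sum empty when k = 0. *)
Lemma sum_forests_split (f : {set 'I_n * 'I_n} -> R) i k :
  \sum_(F | diverging_forest F && (#|F| == k)) w F * f F =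
  \sum_(F | rooted_forest F i && (#|F| == k)) w F * f F +
  \sum_(H | rooted_forest H i && (#|H|.+1 == k))
     w H * \sum_(p | ~~ connect (weak_rel H) i p) eps p i * f ((p, i) |: H).
Proof.
rewrite (bigID (fun F => indegree F i == 0%N)) /=; congr (_ + _).
  by apply: eq_bigl => F; rewrite /rooted_forest andbAC.
(* When [i] is not a root, exactly one [p] satisfies [(p, i) \in F]; when it is a root, none
   does. *)
transitivity (\sum_p \sum_(F | [&& diverging_forest F, #|F| == k & (p, i) \in F])
   w F * f F).
  rewrite (exchange_big_dep (fun F => diverging_forest F && (#|F| == k)))
    /=; last first.
    by move=> p F _ /and3P[-> ->].
  rewrite [LHS]big_mkcond [RHS]big_mkcond; apply: eq_bigr => F _.
  have [/= dF|] := boolP (diverging_forest F); last by [].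
  case: (#|F| == k) => //=.
  rewrite sumr_const -mulr_natr.
  have -> : #|[pred p : 'I_n | (p, i) \in F]| = indegree F i.
    by apply: eq_card => x; rewrite !inE.
  case/andP: dF => _ /forallP/(_ i); case: (indegree F i) => [|[|]] //= _.
    by rewrite mulr0.
  by rewrite mulr1.
transitivity (\sum_p \sum_(H | [&& rooted_forest H i, #|H|.+1 == k
    & ~~ connect (weak_rel H) i p]) w H * (eps p i * f ((p, i) |: H))); last first.
  rewrite (exchange_big_dep (fun H => rooted_forest H i && (#|H|.+1 == k)))
    /=; last first.
    by move=> p H _ /and3P[-> ->].
  apply: eq_bigr => H /andP[Hi Hk]; rewrite mulr_sumr.
  by apply: eq_bigl => p; rewrite Hi Hk.
apply: eq_bigr => p _.
(* For fixed [p], removing the arc [(p, i)] is inverse to inserting it; sets [H] that already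
   contain the arc are excluded on both sides. *)
rewrite (reindex_onto (fun H => (p, i) |: H) (fun F => F :\ (p, i))) /=; last first.
  by move=> F /and3P[_ _ Fpi]; rewrite setD1K.
apply: eq_big => [H|H /andP[_ /eqP HK]].
  rewrite setU11 andbT; have [HpI|nH] := boolP ((p, i) \in H).
    have -> : (((p, i) |: H) :\ (p, i) == H) = false.
      by apply/eqP=> /setP/(_ (p, i)); rewrite !inE eqxx HpI.
    rewrite andbF; apply/esym/negbTE; rewrite !negb_and negbK.
    by rewrite connect1 ?orbT // /weak_rel /arc_rel HpI orbT.
  by rewrite setU1K // eqxx andbT rooted_forest_add // cardsU1 nH -andbA
    [_ && (_ == k)]andbC.
have nH : (p, i) \notin H by rewrite -HK !inE eqxx.
by rewrite /subgraph_weight big_setU1 //= mulrA [w H * _]mulrC.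
Qed.

(** The weight entering [i] from the tree rooted at [j]; it is 0 when [j] is not a root of [F]. *)
Definition tree_sum i F j := \sum_m eps m i * (diverges_from F j m)%:R.

Lemma tree_sum_root i F : rooted_forest F i ->
  \sum_(p | ~~ connect (weak_rel F) i p) eps p i =
  \sum_m eps m i - tree_sum i F i.
Proof.
case/andP=> _ ri; rewrite /tree_sum -sumrB big_mkcond; apply: eq_bigr => m _.
by rewrite /diverges_from ri; case: connect; rewrite /= ?mulr1 ?mulr0 ?subrr ?subr0.
Qed.

Lemma tree_sum_neq i F j : rooted_forest F i -> i != j ->
  \sum_(p | ~~ connect (weak_rel F) i p) eps p i * (diverges_from F j p)%:R =
  tree_sum i F j.
Proof.
move=> Fi nij; rewrite big_mkcond; apply: eq_bigr => m _; case: ifP => // /negbFE c.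
by have := rooted_disjoint m Fi nij; rewrite c andbT => /negPf ->;
  rewrite mulr0.
Qed.

(** Forests with root [i] contribute nothing. In the others, [i] diverges from [j] exactly when the
    tail [p] of the arc entering [i] does. *)
Lemma Qmx_neq k i j : i != j ->
  Qmx G k i j = \sum_(F | rooted_forest F i && (#|F|.+1 == k)) w F * tree_sum i F j.
Proof.
move=> nij; rewrite QmxE (sum_forests_split _ i) big1 ?add0r => [|F /andP[Fi _]].
  apply: eq_bigr => F /andP[Fi _]; rewrite -(tree_sum_neq Fi nij); congr (_ * _).
  apply: eq_bigr => p nip; rewrite diverges_from_add // connect0 andbT.
  by have := rooted_disjoint i Fi nij; rewrite connect0 andbT => /negPf ->.
by have := rooted_disjoint i Fi nij; rewrite connect0 andbT => /negPf ->;
  rewrite mulr0.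
Qed.

Lemma sum_QmxE k i j : \sum_m eps m i * Qmx G k m j =
  \sum_(F | diverging_forest F && (#|F| == k)) w F * tree_sum i F j.
Proof.
under eq_bigr => m _ do rewrite QmxE mulr_sumr.
rewrite exchange_big; apply: eq_bigr => F _; rewrite mulr_sumr.
by apply: eq_bigr => m _; rewrite mulrCA.
Qed.

(** Splitting at [i], the forests rooted at [i] yield the entry of [Qmx G k.+1], and the others
    yield the multiple of the entry of [Qmx G k]. *)
Lemma sum_Qmx_neq k i j : i != j ->
  \sum_m eps m i * Qmx G k m j =
  Qmx G k.+1 i j + (\sum_m eps m i) * Qmx G k i j.
Proof.
move=> nij; rewrite sum_QmxE (sum_forests_split _ i) !Qmx_neq //; congr (_ + _).
rewrite mulr_sumr; apply: eq_bigr => F /andP[Fi _].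
(* Inserting [(p, i)] enlarges the tree of [j] by that of [i] exactly when [p] lies in the tree of
   [j]. With [S] the total weight into [i] and [t_x] the tree sum at [x], the sum becomes
   [(S - t_i) * t_j + t_j * t_i = S * t_j]. *)
have -> : \sum_(p | ~~ connect (weak_rel F) i p)
       eps p i * tree_sum i ((p, i) |: F) j
   = \sum_(p | ~~ connect (weak_rel F) i p)
       (eps p i * tree_sum i F j
        + eps p i * (diverges_from F j p)%:R * tree_sum i F i).
  apply: eq_bigr => p nip; rewrite -mulrA -mulrDr; congr (_ * _).
  rewrite /tree_sum mulr_sumr -big_split; apply: eq_bigr => m _ /=.
  rewrite mulrCA -mulrDr diverges_from_add //; congr (_ * _).
  have := rooted_disjoint m Fi nij; case/andP: Fi => _ ri.
  have -> : diverges_from F i m = connect (weak_rel F) i m.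
    by rewrite /diverges_from ri.
  by case: (connect _ i m); case: (diverges_from F j m);
    case: (diverges_from F j p);
    rewrite //= ?(mul1r, mul0r, addr0, add0r).
rewrite big_split -!mulr_suml /= tree_sum_root // tree_sum_neq //.
by ring.
Qed.

Lemma Qmx_diag k i :
  Qmx G k i i = \sum_(F | rooted_forest F i && (#|F| == k)) w F.
Proof.
rewrite QmxE big_mkcond [RHS]big_mkcond; apply: eq_bigr => F _.
rewrite /rooted_forest /diverges_from connect0 andbT.
by case: diverging_forest; case: (#|F| == k); case: (_ == 0%N);
  rewrite //= ?mulr1 ?mulr0.
Qed.

(** For each forest rooted at [i], the weight into [i] from its own tree and from outside add up to
    the total. The inside part comes from the sum on the left, the outside part from the forests in
    [sigma G k.+1] where [i] is not a root. *)
Lemma sum_Qmx_diag k i :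
  \sum_m eps m i * Qmx G k m i + sigma G k.+1 =
  Qmx G k.+1 i i + (\sum_m eps m i) * Qmx G k i i.
Proof.
have -> : \sum_m eps m i * Qmx G k m i =
    \sum_(F | rooted_forest F i && (#|F| == k)) w F * tree_sum i F i.
  rewrite sum_QmxE (bigID (fun F => indegree F i == 0%N)) /= [X in _ + X]big1 ?addr0.
    by apply: eq_bigl => F; rewrite /rooted_forest andbAC.
  move=> F /andP[_ /negPf nri]; rewrite /tree_sum big1 ?mulr0 // => m _.
  by rewrite /diverges_from nri mulr0.
have -> : sigma G k.+1 = \sum_(F | diverging_forest F && (#|F| == k.+1)) w F * 1.
  by rewrite sigmaE; apply: eq_bigr => F _; rewrite mulr1.
rewrite (sum_forests_split (fun=> 1) i) !Qmx_diag addrCA; congr (_ + _).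
  by apply: eq_bigr => F _; rewrite mulr1.
rewrite -big_split mulr_sumr; apply: eq_bigr => F /andP[Fi _] /=.
under eq_bigr => p _ do rewrite mulr1.
by rewrite tree_sum_root //; ring.
Qed.

Lemma kirchhoff_mul_entry (A : 'M[R]_n) i j :
  (kirchhoff G *m A) i j =
  (\sum_m eps m i) * A i j - \sum_m eps m i * A m j.
Proof.
rewrite mxE (bigD1 i) //= [in RHS](bigD1 i) //= [X in _ - X](bigD1 i) //=.
(* Without loops the terms [m = i] vanish, so both sums may run over all [m]. *)
rewrite weight_loopless add0r mul0r add0r mxE eqxx sumrN opprK; congr (_ + _).
rewrite -sumrN; apply: eq_bigr => m nmi.
by rewrite mxE (negPf nmi) mulNr.
Qed.

Lemma Qmx_rec k : Qmx G k.+1 = (sigma G k.+1)%:M - kirchhoff G *m Qmx G k.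
Proof.
apply/eqP; rewrite eq_sym subr_eq; apply/eqP/matrixP=> i j.
rewrite [RHS]mxE kirchhoff_mul_entry mxE.
have [<-|nij] := eqVneq i j.
  by rewrite mulr1n addrA -sum_Qmx_diag addrAC subrr add0r.
by rewrite mulr0n addrA -sum_Qmx_neq // subrr.
Qed.

Lemma sigma0 : sigma G 0 = 1.
Proof.
rewrite sigmaE (big_pred1 set0) => [|F]; first by rewrite /subgraph_weight big_set0.
by rewrite cards_eq0 /=; case: eqP => [->|]; rewrite ?diverging_forest0 ?andbF.
Qed.

Lemma Qmx0 : Qmx G 0 = 1%:M.
Proof.
apply/matrixP=> i j; rewrite QmxE (big_pred1 set0) => [|F].
  by rewrite /subgraph_weight big_set0 mul1r diverges_from0 mxE.
by rewrite cards_eq0 /=; case: eqP => [->|]; rewrite ?diverging_forest0 ?andbF.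
Qed.

End Recurrence.

Theorem theorem7 (R : realFieldType) (n : nat) (hn : (1 < n)%N)
    (G : wdigraph R n) (k : nat) (hk : (k <= n - out_forest_dim G)%N) :
  Qmx G k = \sum_(i < k.+1) sigma G (k - i)%N *: (- kirchhoff G) ^+ i.
Proof.
elim: k {hk} => [|k IHk].
  by rewrite big_ord1 subnn sigma0 scale1r expr0 Qmx0.
(* The term of exponent 0 is the scalar matrix of the recurrence; the others are [- kirchhoff G]
   times the expansion for [k], with the exponent shifted by one. *)
rewrite Qmx_rec IHk [in RHS]big_ord_recl subn0 expr0 scalemx1 -mulNmx mulmx_sumr.
congr (_ + _); apply: eq_bigr => i _.
by rewrite /= /bump add1n subSS exprS -scalemxAr.
Qed.
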